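(* Let $t\ge 3$, let $\beta\in E^*$ be such that $T=E(\mathbb{1},\beta)$ is a scattered point of $\mathrm{PG}(1,E)$, and suppose there is a projectivity $\varphi$ of $\mathrm{PG}(1,E)$ with $(L_T)^\varphi=L'_T$. Then $L_T$ is of pseudoregulus type.
   Context: Let $q$ be a prime power, $t\ge 2$, and $E=\mathrm{End}_{\mathbb{F}_q}(\mathbb{F}_{q^t})$, the ring of $\mathbb{F}_q$-linear maps $\mathbb{F}_{q^t}\to\mathbb{F}_{q^t}$, maps written on the right ($x\mapsto x^\alpha$) and composed left to right; $\mathbb{1}$ is the identity and $E^*$ the unit group. For $a\in\mathbb{F}_{q^t}$ let $\rho_a\in E$ be $x\mapsto ax$. $E^2$ is a left $E$-module of row vectors with $\mathrm{GL}_2(E)$ acting from the right. A pair $(\alpha,\beta)\in E^2$ is admissible if it is the first row of a matrix in $\mathrm{GL}_2(E)$. The projective line $\mathrm{PG}(1,E)$ is the set of cyclic submodules $E(\alpha,\beta)$ with $(\alpha,\beta)$ admissible (points); $E(\alpha,\beta)=E(\alpha',\beta')$ iff $(\alpha',\beta')=(\gamma\alpha,\gamma\beta)$ for some $\gamma\in E^*$. Two points $E(\alpha,\beta),E(\gamma,\delta)$ are distant if the matrix with rows $(\alpha,\beta)$, $(\gamma,\delta)$ lies in $\mathrm{GL}_2(E)$, non-distant otherwise. A projectivity of $\mathrm{PG}(1,E)$ is a map $E(\alpha,\beta)\mapsto E((\alpha,\beta)M)$ for a fixed $M\in\mathrm{GL}_2(E)$. $\mathrm{PG}(1,F)$ denotes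 $\{E(\rho_a,\rho_b): (a,b)\in\mathbb{F}_{q^t}^2\setminus\{(0,0)\}\}$, and $\iota:\mathrm{PG}(1,q^t)\to\mathrm{PG}(1,E)$, $\langle(a,b)\rangle_{q^t}\mapsto E(\rho_a,\rho_b)$. For a point $T$, $L_T$ is the set of points of $\mathrm{PG}(1,F)$ non-distant to $T$; for $T=E(\alpha,\beta)$ and $h\in\mathbb{F}_{q^t}^*$, $Th=E(\alpha\rho_h,\beta\rho_h)$, and $L'_T=\{Th: h\in\mathbb{F}_{q^t}^*\}$. $T$ is scattered if $|L_T|=(q^t-1)/(q-1)$. A subset of $\mathrm{PG}(1,q^t)$ is a linear set of pseudoregulus type if it is the image under some element of $\mathrm{PGL}_2(q^t)$ of $\{\langle(1,u^{q-1})\rangle_{q^t}: u\in\mathbb{F}_{q^t}^*\}$ (equivalently of $\{\langle(u,u^{\tau})\rangle_{q^t}: u\in\mathbb{F}_{q^t}^*\}$ for any generator $\tau$ of $\mathrm{Gal}(\mathbb{F}_{q^t}/\mathbb{F}_q)$). The set $L_T$ is of pseudoregulus type if $\iota^{-1}(L_T)$ is a linear set of pseudoregulus type. *)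

(* Defs.v *)
From HB Require Import structures.
From mathcomp Require Import all_boot all_order all_algebra all_field.
From mathcomp Require Import boolp classical_sets functions cardinality.

Set Implicit Arguments.
Unset Strict Implicit.
Unset Printing Implicit Defensive.

Import GRing.Theory.
(* Makes 'End(L) canonically a ring with (f * g) x = g (f x): maps are composed
   left to right, as when they are written on the right of their argument. *)
Export FalgLfun.

Local Open Scope classical_set_scope.
Local Open Scope card_scope.
Local Open Scope ring_scope.

Definition row2 (R : Type) (a b : R) : 'rV[R]_2 :=
  \row_(i < 2) if i == ord0 then a else b.

Section LineOverRing.
Variable R : nzRingType.
Implicit Types (v w : 'rV[R]_2) (M : 'M[R]_2) (X Y : set 'rV[R]_2).

(* [unitmx] is only available over commutative rings. *)
Definition GL2 M : Prop :=
  exists N : 'M[R]_2, M *m N = 1%:M /\ N *m M = 1%:M.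

Definition admissible v : Prop := exists w, GL2 (col_mx v w).

(* The cyclic left submodule R(a, b); the points of PG(1, R) are the cyc v with
   v admissible. *)
Definition cyc v : set 'rV[R]_2 := [set w | exists c : R, w = c *: v].

(* If (v; w) is in GL_2 then v and w are admissible. Over 'End(L) the choice of
   generators is irrelevant: they are unique up to left factors in the unit
   group. *)
Definition distant X Y : Prop :=
  exists v w, [/\ X = cyc v, Y = cyc w & GL2 (col_mx v w)].

(* Only the values of phi at the points matter. *)
Definition projectivity (phi : set 'rV[R]_2 -> set 'rV[R]_2) : Prop :=
  exists2 M, GL2 M & forall v, admissible v -> phi (cyc v) = cyc (v *m M).

End LineOverRing.

Section EndomorphismLine.
Variables (F : finFieldType) (L : fieldExtType F).

Notation E := 'End(L).
Notation point := (set 'rV[E]_2).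

Definition rho (a : L) : E := amull a.

Definition PGF : set point :=
  [set X | exists a b : L, (a, b) != (0, 0) /\ X = cyc (row2 (rho a) (rho b))].

Definition LT (T : point) : set point := [set X | PGF X /\ ~ distant X T].

(* T h, as the image of the submodule T; see dilate_cyc. *)
Definition dilate (T : point) (h : L) : point :=
  [set v *m (rho h)%:M | v in T].

Lemma dilate_cyc (alpha beta : E) (h : L) :
  dilate (cyc (row2 alpha beta)) h = cyc (row2 (alpha * rho h) (beta * rho h)).
Proof.
have e : row2 alpha beta *m (rho h)%:M = row2 (alpha * rho h) (beta * rho h).
  apply/matrixP=> i j; rewrite !mxE (bigD1 j) //= !mxE eqxx mulr1n big1 ?addr0.
    by case: ifP.
  by move=> k kj; rewrite !mxE (negPf kj) mulr0n mulr0.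
apply/seteqP; split=> w /=.
  by case=> _ [c ->] <-; exists c; rewrite -scalemxAl e.
by case=> c ->; exists (c *: row2 alpha beta);
  [exists c | rewrite -scalemxAl e].
Qed.

Definition LT' (T : point) : set point :=
  [set dilate T h | h in [set h : L | h != 0]].

Definition scattered (T : point) : Prop :=
  LT T #= `I_((#|F| ^ \dim {:L}).-1 %/ (#|F|).-1)%N.

(* Points of PG(1,q^t) are the L-subspaces of dimension 1 of 'rV[L]_2. *)
Notation Lspace := {vspace 'rV[L]_2}.

(* Independent of the representative of P: see iota_line. *)
Definition iota (P : Lspace) : point := cyc (map_mx rho (vpick P)).

Lemma iota_line (a b : L) : (a, b) != (0, 0) ->
  iota <[row2 a b]>%VS = cyc (row2 (rho a) (rho b)).
Proof.
move=> ab0; set v := row2 a b.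
have v0 : v != 0.
  apply: contra_neq ab0 => /matrixP e.
  by move: (e 0 0) (e 0 (lift 0 0)); rewrite !mxE /= => -> ->.
have scal c (w : 'rV[L]_2) : map_mx rho (c *: w) = rho c *: map_mx rho w.
  by apply/matrixP=> i j; rewrite !mxE /rho mulrC amullM.
have map_v : map_mx rho v = row2 (rho a) (rho b).
  by apply/matrixP=> i j; rewrite !mxE; case: ifP.
have /vlineP[c ec] := memv_pick <[v]>%VS.
have c0 : c != 0.
  have : vpick <[v]>%VS != 0 by rewrite vpick0 -dimv_eq0 dim_vline v0.
  by rewrite ec scaler_eq0 negb_or => /andP[].
rewrite /iota ec scal map_v; apply/seteqP; split=> w /= [d ->].
  by exists (d * rho c); rewrite scalerA.
exists (d * rho c^-1); rewrite scalerA -mulrA /rho -amullM mulfV //.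
by rewrite amull1 mulr1.
Qed.

Definition iota_preim (S : set point) : set Lspace :=
  [set P | \dim P = 1%N /\ S (iota P)].

Definition pgl (M : 'M[L]_2) (P : Lspace) : Lspace :=
  (linfun (mulmxr M : 'rV[L]_2 -> 'rV[L]_2) @: P)%VS.

Lemma pgl_line (M : 'M[L]_2) (v : 'rV[L]_2) :
  pgl M <[v]>%VS = <[v *m M]>%VS.
Proof. by rewrite /pgl limg_line lfunE. Qed.

Definition pseudoregulus_linear_set (S : set Lspace) : Prop :=
  exists2 M : 'M[L]_2, M \in unitmx &
    S = pgl M @`
      [set <[row2 1%R (u ^+ (#|F|).-1)%R]>%VS | u in [set u : L | u != 0]].

Definition pseudoregulus_type (S : set point) : Prop :=
  pseudoregulus_linear_set (iota_preim S).

End EndomorphismLine.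

(* Main.v *)
(* Over F the point T is the subspace U = {(x, beta x)} of L^2, and L_T is the set
   of lines S_b = {(p, b p)} of L^2 that meet U nontrivially. A projectivity
   taking L_T to L'_T is an F-linear bijection Phi of L^2 mapping the S_b onto
   the multiples h U. Hence the field of maps g k = Phi^-1 k Phi, k in L,
   permutes the S_b transitively. Preserving four lines of L_T, each g k turns
   multiplication by their cross ratio c into multiplication by some c'; as
   g (k + 1) = g k + 1 does so too, c' = c. The cross ratios are too many to lie
   in a proper F-subspace of L (this needs t >= 3), so all the g k are L-linear
   and, being powers of one g w, simultaneously diagonalizable: L_T is an orbit
   {(1, r^i)} M. Since w^theta is in F, where theta = |L_T|, the ratio r of the
   eigenvalues of g w is a primitive theta-th root of unity, so that its powers
   are the elements u^(q-1). *)

Require Import Defs.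
From HB Require Import structures.
From mathcomp Require Import all_boot all_order all_algebra all_field.
From mathcomp Require Import boolp classical_sets functions cardinality.
From mathcomp Require Import cyclic ring.

Set Implicit Arguments.
Unset Strict Implicit.
Unset Printing Implicit Defensive.

Import GRing.Theory.

Local Open Scope classical_set_scope.
Local Open Scope ring_scope.

(** * Row vectors of length two and cross ratios *)

Lemma row2_eta (R : Type) (v : 'rV[R]_2) : v = row2 (v 0 0) (v 0 (lift 0 0)).
Proof.
apply/rowP=> j; rewrite mxE; case: (unliftP ord0 j) => [k|] ->.
  by rewrite (ord1 k).
by rewrite eqxx.
Qed.

Lemma row2_inj (R : Type) (a b c d : R) :
  row2 a b = row2 c d -> a = c /\ b = d.
Proof. by move=> /rowP e; move: (e 0) (e (lift 0 0)); rewrite !mxE. Qed.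

Lemma row2D (R : nmodType) (a b c d : R) :
  row2 a b + row2 c d = row2 (a + c) (b + d).
Proof. by apply/rowP=> j; rewrite !mxE; case: ifP. Qed.

Lemma row2Z (R : nzRingType) (a b c : R) : c *: row2 a b = row2 (c * a) (c * b).
Proof. by apply/rowP=> j; rewrite !mxE; case: ifP. Qed.

Lemma row2_decomp (K : fieldType) (b0 b1 : K) (v : 'rV[K]_2) : b0 != b1 ->
  exists p r : K, v = p *: row2 1 b0 + r *: row2 1 b1.
Proof.
move=> nb; have nz : b0 - b1 != 0 by rewrite subr_eq0.
rewrite (row2_eta v); move: (v 0 0) (v 0 (lift 0 0)) => x y.
exists ((y - b1 * x) / (b0 - b1)), ((b0 * x - y) / (b0 - b1)).
by rewrite !row2Z row2D; congr row2; field.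
Qed.

(** The value at [b] of the Möbius map that sends [b0], [b1], [b2] to 0, infinity, 1. *)
Definition cross_ratio (K : fieldType) (b0 b1 b2 b : K) : K :=
  (b0 - b) * (b2 - b1) / ((b - b1) * (b0 - b2)).

(** Requiring sums to lie on the line of [d] matches vectors on the line of [b0] with vectors on the
    line of [b1], and [f], being additive, respects such matchings. The matchings for [b] and [b2]
    differ by the cross ratio, their images by the cross ratio of the [tau] values. *)
Lemma cross_ratio_semilinear (K : fieldType) (f : 'rV[K]_2 -> 'rV[K]_2)
    (tau : K -> K) (B : pred K) (b0 b1 b2 b : K) :
    {morph f : v w / v + w} ->
    (forall b' p, b' \in B -> exists x, f (p *: row2 1 b') = x *: row2 1 (tau b')) ->
    {in B &, injective tau} ->
    b0 \in B -> b1 \in B -> b2 \in B -> b \in B ->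
    b0 != b1 -> b0 != b2 -> b2 != b1 -> b != b1 ->
  exists c, forall v, f (cross_ratio b0 b1 b2 b *: v) = c *: f v.
Proof.
move=> fD fB tauI B0 B1 B2 Bb n01 n02 n21 nb1.
have tauN x y : x \in B -> y \in B -> x != y -> tau x - tau y != 0.
  by move=> Bx By; rewrite subr_eq0; apply: contra_neq; apply: tauI.
have N z w : z != w -> z - w != 0 :> K by rewrite subr_eq0.
(* p (1, b0) + m p (1, b1) lies on the line of (1, d) *)
pose m d := (b0 - d) / (d - b1); pose mu d := (tau b0 - tau d) / (tau d - tau b1).
have key d p x : d \in B -> d != b1 -> f (p *: row2 1 b0) = x *: row2 1 (tau b0) ->
    f (m d * p *: row2 1 b1) = mu d * x *: row2 1 (tau b1).
  move=> Bd nd ex; have [y ey] := fB b1 (m d * p) B1.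
  have [z ez] := fB d (p + m d * p) Bd.
  have : p *: row2 1 b0 + m d * p *: row2 1 b1 = (p + m d * p) *: row2 1 d.
    rewrite !row2Z row2D; congr row2; rewrite ?mulr1 //.
    by rewrite /m; field; exact: N.
  move/(congr1 f); rewrite fD ex ey ez !row2Z row2D => /(@row2_inj K)[].
  rewrite !mulr1 => <- e2; suff -> : y = mu d * x by [].
  apply: (mulfI (tauN d b1 Bd B1 nd)); transitivity ((tau b0 - tau d) * x).
    have -> : (tau d - tau b1) * y = (x + y) * tau d - x * tau d - y * tau b1 by ring.
    by rewrite -e2; ring.
  by rewrite /mu; field; exact: tauN.
set c := cross_ratio _ _ _ _; have cm : c * m b2 = m b.
  by rewrite /c /cross_ratio /m; field; rewrite !N.
have m0 : m b2 != 0 by rewrite mulf_neq0 ?invr_eq0 ?N.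
have mu0 : mu b2 != 0 by rewrite mulf_neq0 ?invr_eq0 ?tauN.
(* As [m b2 * c = m b], [key] for [b2] at [c * p] and [key] for [b] at [p] compute the same
   vector. *)
have c0 p : f (c * p *: row2 1 b0) = mu b / mu b2 *: f (p *: row2 1 b0).
  have [x ex] := fB b0 p B0; have [x' ex'] := fB b0 (c * p) B0.
  have := key b2 _ _ B2 n21 ex'; have := key b _ _ Bb nb1 ex.
  rewrite [m b2 * _]mulrA [m b2 * c]mulrC cm => -> e.
  have {}e : mu b * x = mu b2 * x'.
    by move: e; rewrite !row2Z => /(@row2_inj K)[+ _]; rewrite !mulr1.
  by rewrite ex ex' scalerA; congr (_ *: _); rewrite mulrAC e; field.
have c1 r : f (c * r *: row2 1 b1) = mu b / mu b2 *: f (r *: row2 1 b1).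
  pose p := r / m b2; have [x ex] := fB b0 p B0.
  have := key b _ _ Bb nb1 ex; have := key b2 _ _ B2 n21 ex.
  have -> : m b2 * p = r by rewrite /p mulrC divfK.
  have -> : m b * p = c * r by rewrite /p -cm; field.
  by move=> -> ->; rewrite scalerA; congr (_ *: _); field.
exists (mu b / mu b2) => v; have [p [r ->]] := row2_decomp v n01.
by rewrite scalerDr !scalerA !fD c0 c1 scalerDr.
Qed.

(** * Counting and roots of unity in the extension field *)

Lemma ratio_predX (q t : nat) : (0 < q)%N ->
  (((q ^ t).-1 %/ q.-1) * q.-1 = (q ^ t).-1)%N.
Proof. by move=> q0; rewrite divnK // predn_exp dvdn_mulr. Qed.

(** The right side is q + ... + q^(t-1), which has a term besides the last one once [t] is at least
    3; for [t = 2] the two sides agree. *)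
Lemma ratio_predX_gt (q t : nat) : (1 < q)%N -> (3 <= t)%N ->
  (q ^ t.-1 < ((q ^ t).-1 %/ q.-1).-1)%N.
Proof.
case: q => [|[|q]] //; case: t => [|[|[|t]]] // _ _.
rewrite predn_exp mulKn // 2!big_ord_recr big_ord_recl /=.
by rewrite -[ltnLHS]add0n ltn_add2r addn_gt0 expn_gt0 orbT.
Qed.

Section FieldExtension.
Variables (F : finFieldType) (L : fieldExtType F).
Notation q := #|F|.
Notation t := (\dim {:L}).
Notation theta := ((q ^ t).-1 %/ q.-1)%N.
Notation V := 'rV[L]_2.

(** A proper [F]-subspace of [L] has at most q^(t-1) elements. *)
Lemma span_full (S : seq L) : uniq S -> (q ^ t.-1 < size S)%N ->
  <<S>>%VS = fullv.
Proof.
move=> uS szS; apply/eqP; rewrite eqEdim subvf /=.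
suff : (t.-1 < \dim <<S>>)%N by case: t.
rewrite -(ltn_exp2l _ _ (finNzRing_gt1 F)); apply: leq_trans szS _.
pose V := <<S : seq (finvect_type L)>>%VS.
rewrite -[X in (_ <= X)%N](card_vspace V) cardE; apply: uniq_leq_size => //.
by move=> x xS; apply: etrans (mem_enum V x) (memv_span xS).
Qed.

Lemma card_finvect : #|{: finvect_type L}| = (q ^ t)%N.
Proof.
rewrite -(card_vspace (fullv : {vspace finvect_type L})).
by apply/esym/card_vspacef.
Qed.

(** All q^t - 1 nonzero elements satisfy x^(q^t - 1) = 1, and that many roots of unity in a field
    include a primitive one. *)
Lemma prim_root_exists : exists w : L, ((q ^ t).-1).-primitive_root w.
Proof.
have Q1 : (1 < q ^ t)%N by rewrite -card_finvect finNzRing_gt1.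
pose T : finFieldType := finvect_type L.
have Q0 : (0 < (q ^ t).-1)%N by rewrite -ltnS prednK // ltnW.
suff /hasP[w _ ?] : has (q ^ t).-1.-primitive_root (enum (predC1 (0 : T))).
  by exists w.
apply: has_prim_root => //; last 2 first.
- exact: enum_uniq.
- by rewrite -cardE cardC1 card_finvect.
apply/allP=> x; rewrite mem_enum /= unity_rootE => x0.
by apply/eqP/(mulfI x0); rewrite -exprS prednK ?mulr1 ?(ltnW Q1) //
  -card_finvect expf_card.
Qed.

(** * Scalar multiplication transported to the lines with slope in [B] *)

Section Transport.
Variables (Phi Psi : V -> V) (U : set V) (B : seq L).
Hypotheses (PhiK : cancel Phi Psi) (PsiK : cancel Psi Phi).
Hypothesis PhiD : {morph Phi : v w / v + w}.
Hypothesis PhiF : forall (a : F) v, Phi (a%:A *: v) = a%:A *: Phi v.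

Definition on_line (b : L) (v : V) := exists p, v = p *: row2 1 b.

(** With [U_line], this matches the lines with slope in [B] with the multiples [h U]; in the
    application [U] is the subspace of [L^2] belonging to [T]. *)
Hypothesis line_U : forall b, b \in B ->
  exists2 h, h != 0 & forall v, on_line b v <-> U (h^-1 *: Phi v).
Hypothesis U_line : forall h, h != 0 ->
  exists2 b, b \in B & forall v, on_line b v <-> U (h^-1 *: Phi v).
Hypothesis B_uniq : uniq B.
Hypothesis B_size : size B = theta.
Hypothesis t_ge3 : (3 <= t)%N.

Definition conj_scale (k : L) (v : V) : V := Psi (k *: Phi v).
Local Notation g := conj_scale.

Lemma PsiD : {morph Psi : v w / v + w}.
Proof. by move=> v w; rewrite -[v]PsiK -[w]PsiK -PhiD !PhiK. Qed.

Lemma PsiF (a : F) v : Psi (a%:A *: v) = a%:A *: Psi v.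
Proof. by rewrite -[v]PsiK -PhiF !PhiK. Qed.

Lemma conj_scaleDr k : {morph g k : v w / v + w}.
Proof. by move=> v w; rewrite /g PhiD scalerDr PsiD. Qed.

Lemma conj_scaleDl k l v : g (k + l) v = g k v + g l v.
Proof. by rewrite /g scalerDl PsiD. Qed.

Lemma conj_scaleM k l v : g (k * l) v = g k (g l v).
Proof. by rewrite /g PsiK scalerA. Qed.

Lemma conj_scale_alg (a : F) v : g a%:A v = a%:A *: v.
Proof. by rewrite /g PsiF PhiK. Qed.

Lemma conj_scale1 v : g 1 v = v.
Proof. by rewrite /g scale1r PhiK. Qed.

Lemma conj_scaleF k (a : F) v : g k (a%:A *: v) = a%:A *: g k v.
Proof. by rewrite -!conj_scale_alg -!conj_scaleM mulrC. Qed.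

Lemma on_line_inj b c : (forall v, on_line b v <-> on_line c v) -> b = c.
Proof.
move=> e; have [|p] := (e (row2 1 b)).1; first by exists 1; rewrite scale1r.
by rewrite row2Z => /(@row2_inj L)[]; rewrite mulr1 => <-; rewrite mul1r.
Qed.

(** [Phi] sends the line to some [h U], and the multiple [(h * k) U] comes from a line again. *)
Lemma line_conj_scale k b : k != 0 -> b \in B ->
  exists2 b', b' \in B & forall v, on_line b v <-> on_line b' (g k v).
Proof.
move=> k0 Bb; have [h h0 hb] := line_U Bb.
have [b' Bb' hb'] := U_line (mulf_neq0 h0 k0).
exists b' => // v; rewrite hb hb' /g PsiK scalerA invfM mulrAC -mulrA mulfV //.
by rewrite mulr1.
Qed.

Lemma conj_scale_trans b b' : b \in B -> b' \in B ->
  exists2 k, k != 0 & forall v, on_line b v <-> on_line b' (g k v).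
Proof.
move=> Bb Bb'; have [h h0 hb] := line_U Bb; have [h' h'0 hb'] := line_U Bb'.
exists (h' / h); first by rewrite mulf_neq0 ?invr_eq0.
move=> v; rewrite hb hb' /g PsiK scalerA mulrA mulVf // mul1r.
by [].
Qed.

Lemma conj_scale_cross_ratio b0 b1 b2 b k :
    b0 \in B -> b1 \in B -> b2 \in B -> b \in B ->
    b0 != b1 -> b0 != b2 -> b2 != b1 -> b != b1 -> k != 0 ->
  exists c, forall v, g k (cross_ratio b0 b1 b2 b *: v) = c *: g k v.
Proof.
move=> B0 B1 B2 Bb n01 n02 n21 nb1 k0.
(* [choice] yields a total function; outside [B] the value [d] is a dummy. *)
have /choice[tau tauB] d : exists d', d \in B ->
    d' \in B /\ forall v, on_line d v <-> on_line d' (g k v).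
  have [dB|_] := boolP (d \in B); last by exists d.
  by have [d' Bd' e] := line_conj_scale k0 dB; exists d'.
apply: (@cross_ratio_semilinear _ _ tau (mem B)) => //.
- exact: conj_scaleDr.
- by move=> d p dB; apply/(tauB d dB).2; exists p.
move=> d d' dB d'B e; apply: on_line_inj => v.
by rewrite (tauB d dB).2 (tauB d' d'B).2 e.
Qed.

(* If g k scales c into c' and g (k + 1) = g k + 1 scales c into c'', then
   (c' - c'') g k = c'' - c, so g k is itself a scalar unless c' = c'' = c. *)
Lemma conj_scale_linear_at c :
    (forall k, k != 0 -> exists c', forall v, g k (c *: v) = c' *: g k v) ->
  forall k v, g k (c *: v) = c *: g k v.
Proof.
move=> gc k; have g0 v : g 0 v = 0.
  by rewrite -(scale0r (1 : L)) conj_scale_alg scale0r scale0r.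
have [->|k0] := eqVneq k 0; first by move=> v; rewrite !g0 scaler0.
have [c' ec'] := gc k k0.
have gN1 v : g (- 1) v = - v.
  by apply/eqP; rewrite -addr_eq0 -[X in _ + X]conj_scale1 -conj_scaleDl addNr g0.
have [k1|k1] := eqVneq (k + 1) 0.
  by move=> v; rewrite -(addrK 1 k) k1 add0r !gN1 scalerN.
have [c'' ec''] := gc _ k1.
have e v : (c' - c'') *: g k v = (c'' - c) *: v.
  move: (ec'' v); rewrite !conj_scaleDl ec' !conj_scale1 scalerDr => e.
  by apply/eqP; rewrite !scalerBl subr_eq addrAC eq_sym subr_eq e addrC.
have [cc|cc] := eqVneq c' c''.
  move=> v; rewrite ec'; congr (_ *: _); apply/eqP; rewrite -subr_eq0 cc.
  have := e (row2 1 0); rewrite cc subrr scale0r row2Z => /esym/rowP/(_ 0).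
  by rewrite !mxE mulr1 => /eqP.
have {}cc : c' - c'' != 0 by rewrite subr_eq0.
have ge v : g k v = (c' - c'')^-1 * (c'' - c) *: v.
  by rewrite -scalerA -e scalerA mulVf // scale1r.
by move=> v; rewrite !ge !scalerA mulrC.
Qed.

Lemma theta_gt3 : (3 < theta)%N.
Proof.
rewrite -ltn_predRL; apply: leq_ltn_trans (ratio_predX_gt _ t_ge3).
  apply: leq_trans (ltnW (ltn_expl _ (finNzRing_gt1 F))).
  by rewrite ltn_predRL.
exact: finNzRing_gt1.
Qed.

Lemma conj_scale_linear k c v : g k (c *: v) = c *: g k v.
Proof.
have sB : (3 < size B)%N by rewrite B_size theta_gt3.
have [b0 [b1 [b2 [[B0 B1 B2] [n01 n02 n21]]]]] : exists b0 b1 b2,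
    [/\ b0 \in B, b1 \in B & b2 \in B] /\ [/\ b0 != b1, b0 != b2 & b2 != b1].
  move: sB B_uniq; case: B => [|x [|y [|z s]]] //= _.
  rewrite !inE !negb_or => /andP[/and3P[xy xz _] /andP[/andP[yz _] _]].
  by exists x, y, z; split; split; rewrite ?inE ?eqxx ?orbT // eq_sym.
(* The slope [b1] is left out, being the pole of the cross ratio. The remaining theta - 1 values
   exceed q^(t-1) in number, so [S] spans [L] over [F]. *)
pose S := [seq cross_ratio b0 b1 b2 b | b <- rem b1 B].
have uS : uniq S.
  rewrite map_inj_in_uniq ?rem_uniq // => x y.
  rewrite !mem_rem_uniq // !inE => /andP[x1 _] /andP[y1 _].
  have N z w : z != w -> z - w != 0 :> L by rewrite subr_eq0.
  move=> e; apply/eqP; rewrite eq_sym -subr_eq0.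
  (* The difference of the cross ratios at [x] and [y] is [y - x] times a factor that cannot
     vanish. *)
  have /eqP : (y - x) * ((b0 - b1) * (b2 - b1) /
      ((x - b1) * (y - b1) * (b0 - b2))) = 0.
    rewrite -(subrr (cross_ratio b0 b1 b2 y)) -[X in _ = X - _]e /cross_ratio.
    by field; rewrite !N.
  rewrite mulf_eq0 => /orP[]; first by [].
  by rewrite !(mulf_eq0, invr_eq0, subr_eq0) (negPf n01) (negPf n21) (negPf x1)
    (negPf y1) (negPf n02).
have gS c' : c' \in S -> forall k v, g k (c' *: v) = c' *: g k v.
  case/mapP=> b; rewrite mem_rem_uniq // inE => /andP[nb1 Bb] -> {}k {}v.
  by apply: conj_scale_linear_at => l; apply: conj_scale_cross_ratio.
have : c \in <<S>>%VS.
  rewrite span_full ?memvf // size_map size_rem // B_size.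
  exact/ratio_predX_gt/t_ge3/finNzRing_gt1.
rewrite -[S]in_tupleE => /coord_span->.
apply: (big_ind (fun d => g k (d *: v) = d *: g k v)).
- by rewrite !scale0r -(scale0r 0) -(scale0r 1) conj_scaleF !scale0r.
- by move=> d e ed ee; rewrite !scalerDl conj_scaleDr ed ee.
by move=> i _; rewrite -mulr_algl -!scalerA conj_scaleF gS // mem_nth.
Qed.

Lemma expf_ext (x : L) : x ^+ (q ^ t) = x.
Proof. by apply/eqP; rewrite -(Fermat's_little_theorem {:L}%AS) memvf. Qed.

Lemma ground_fieldP (x : L) : x ^+ q = x -> exists a : F, x = a%:A.
Proof.
move=> xq; have : x \in 1%AS by rewrite Fermat's_little_theorem (dimv1 L) expn1 xq.
by case/vlineP=> a ->; exists a.
Qed.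

Lemma conj_scale0 k : g k 0 = 0.
Proof. by rewrite -(scale0r 0) conj_scale_linear !scale0r. Qed.

Lemma conj_scale_eq0 k v : k != 0 -> g k v = 0 -> v = 0.
Proof.
move=> k0 e; rewrite -(conj_scale1 v) -(mulVf k0) conj_scaleM e.
exact: conj_scale0.
Qed.

Lemma conj_scale_mx k : exists G : 'M[L]_2, forall v, g k v = v *m G.
Proof.
exists (\matrix_i g k (delta_mx 0 i)) => v.
rewrite mulmx_sum_row {1}[v]row_sum_delta.
rewrite (big_morph _ (conj_scaleDr k) (conj_scale0 k)).
by apply: eq_bigr => i _; rewrite conj_scale_linear rowK.
Qed.

(* The matrix G of g k satisfies G ^ (q ^ t) = G, and 'X^(q ^ t) - 'X splits
   over L with simple roots. *)
Lemma conj_scale_diag k : exists2 P : 'M[L]_2, P \in unitmx &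
  exists d0 d1, forall x y, g k (row2 x y *m P) = row2 (d0 * x) (d1 * y) *m P.
Proof.
have [G eG] := conj_scale_mx k.
have : diagonalizable G.
  apply/diagonalizableP; exists (enum (finvect_type L)); first exact: enum_uniq.
  have GX n v : v *m (G ^+ n) = g (k ^+ n) v.
    elim: n v => [|n IH] v; first by rewrite mulmx1 conj_scale1.
    by rewrite exprS mulmxA -eG IH exprSr conj_scaleM.
  have := finField_genPoly (finvect_type L); rewrite card_finvect -big_enum => e.
  have <- : 'X^(q ^ t) - 'X = \prod_(x <- enum (finvect_type L)) ('X - x%:P)
    :> {poly L} := e.
  apply/mxminpoly_minP; rewrite rmorphB rmorphXn /= horner_mx_X.
  by apply/row_matrixP=> i; rewrite !rowE mulmxBr GX expf_ext -eG subrr mulmx0.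
(* The rows of [P] are eigenvectors of [G]. *)
case=> P Pu /diagonalizable_forPex[d /(simmxP Pu) e]; exists P => //.
exists (d 0 0), (d 0 (lift 0 0)) => x y; rewrite eG -mulmxA e mulmxA; congr (_ *m _).
rewrite mul_mx_diag [LHS]row2_eta !mxE /=.
by rewrite mulrC [y * _]mulrC.
Qed.

Lemma vline_eq (u v : V) c : v != 0 -> v = c *: u -> (<[v]> = <[u]>)%VS.
Proof.
move=> v0 e; apply/eqP; rewrite eqEdim !dim_vline v0 -memvE.
by rewrite e memvZ ?memv_line // leq_b1.
Qed.

Lemma row2_neq0 (a b : L) : a != 0 -> row2 a b != 0.
Proof. by apply: contra_neq => /rowP/(_ 0); rewrite !mxE. Qed.

Lemma transport_pseudoregulus :
  pseudoregulus_linear_set [set <[row2 1%R b]>%VS | b in [set` B]].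
Proof.
have [w wP] := prim_root_exists.
have q1 := finNzRing_gt1 F.
have Q1 : (1 < q ^ t)%N by rewrite -card_finvect finNzRing_gt1.
have nE := ratio_predX t (ltnW q1); set n := (q ^ t).-1 in wP nE.
have n0 : (0 < n)%N := prim_order_gt0 wP.
have theta0 : (0 < theta)%N by apply: leq_trans theta_gt3.
have w0 : w != 0.
  apply/eqP=> e; have /eqP := prim_expr_order wP.
  by rewrite e expr0n (gtn_eqF n0) eq_sym oner_eq0.
have Xn1 x : x != 0 -> x ^+ n = 1 :> L.
  by move=> x0; apply: (mulfI x0); rewrite -exprS prednK ?(ltnW Q1) // expf_ext mulr1.
have powW k : k != 0 -> exists i, k = w ^+ i.
  by move=> /Xn1 /(prim_rootP wP)[i ->]; exists i.
have [P Pu [d0 [d1 gP]]] := conj_scale_diag w.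
have gPX i x y : g (w ^+ i) (row2 x y *m P) = row2 (d0 ^+ i * x) (d1 ^+ i * y) *m P.
  elim: i x y => [|i IH] x y; first by rewrite !expr0 conj_scale1 !mul1r.
  by rewrite exprSr conj_scaleM gP IH !mulrA -!exprSr.
have Pinj u v : u *m P = v *m P -> u = v by apply: (can_inj (mulmxK Pu)).
have [b0 Bb0] : exists b, b \in B.
  by move: theta0; rewrite -B_size; case: B => // b s _; exists b; rewrite inE eqxx.
have [x [y exy]] : exists x y, row2 1 b0 = row2 x y *m P.
  by exists ((row2 1 b0 *m invmx P) 0 0), ((row2 1 b0 *m invmx P) 0 (lift 0 0));
    rewrite -row2_eta mulmxKV.
(* A common eigenvector would stay on its line under all [g k], but the line of [b0] is moved to
   every line with slope in [B], and there are more than three. *)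
have nofix : ~ exists d, forall i, g (w ^+ i) (row2 1 b0) = d ^+ i *: row2 1 b0.
  case=> d gd; suff : (size B <= size [:: b0])%N.
    by rewrite B_size leqNgt (leq_trans _ theta_gt3).
  apply: uniq_leq_size => // b Bb; rewrite inE.
  have [k k0 kb] := conj_scale_trans Bb0 Bb; have [i ei] := powW k k0.
  have [|p] := (kb (row2 1 b0)).1; first by exists 1; rewrite scale1r.
  rewrite ei gd !row2Z => /(@row2_inj L)[]; rewrite !mulr1 => <- /mulfI -> //.
  apply: contraTneq isT => di0.
  have := conj_scale_eq0 k0 (v := row2 1 b0); rewrite ei gd di0 scale0r => /(_ erefl).
  by move/eqP; rewrite (negPf (row2_neq0 _ (oner_neq0 L))).
have x0 : x != 0.
  apply: contra_notN nofix => /eqP x0; exists d1 => i.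
  by rewrite exy x0 gPX mulr0 scalemxAl row2Z mulr0.
have y0 : y != 0.
  apply: contra_notN nofix => /eqP y0; exists d0 => i.
  by rewrite exy y0 gPX mulr0 scalemxAl row2Z mulr0.
(* The eigenbasis is rescaled so that [row2 1 1 *m M = row2 1 b0]. With [r = d1 / d0], [g (w ^+ i)]
   then maps this vector to a multiple of [row2 1 (r ^+ i) *m M]. *)
pose M := diag_mx (row2 x y) *m P.
have row2M a b : row2 a b *m M = row2 (a * x) (b * y) *m P.
  by rewrite mulmxA mul_mx_diag [_ *m P in RHS]/=; congr (_ *m _);
     rewrite [LHS]row2_eta !mxE.
have Mu : M \in unitmx.
  rewrite unitmx_mul Pu andbT unitmxE det_diag unitfE.
  by apply/prodf_neq0 => j _; rewrite mxE; case: ifP.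
have d00 : d0 != 0.
  apply/eqP=> e; suff /Pinj/eqP : row2 1 0 *m P = 0 *m P.
    by apply/negP; rewrite row2_neq0 ?oner_eq0.
  rewrite mul0mx; apply: (conj_scale_eq0 w0); rewrite gP e mul0r mulr0.
  suff -> : row2 0 0 = 0 :> V by rewrite mul0mx.
  by apply/rowP=> j; rewrite !mxE if_same.
(* Frobenius multiplies [w ^+ theta] by its power of exponent q - 1, which is [w ^+ n = 1]. So
   [g (w ^+ theta)] is a scalar from [F], and both eigenvalues have the same theta-th power. *)
have [a ea] : exists a : F, w ^+ theta = a%:A.
  apply: ground_fieldP.
  have expq z : z ^+ q = z * z ^+ q.-1 :> L by rewrite -exprS prednK // ltnW.
  by rewrite expq -exprM nE (prim_expr_order wP) mulr1.
have [d0a d1a] : d0 ^+ theta = a%:A /\ d1 ^+ theta = a%:A.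
  apply: (@row2_inj L); apply: Pinj; rewrite -[d0 ^+ _]mulr1 -[d1 ^+ _]mulr1 -gPX ea.
  by rewrite conj_scale_alg scalemxAl row2Z !mulr1.
pose r := d1 / d0.
have r1 : r ^+ theta = 1.
  by rewrite exprMn exprVn d1a -d0a mulfV // expf_neq0.
have uM i : row2 1 (r ^+ i) *m M != 0.
  apply: contra_neq (row2_neq0 (r ^+ i) (oner_neq0 L)) => e.
  by apply: (can_inj (mulmxK Mu)); rewrite e mul0mx.
have lineX i b : on_line b (g (w ^+ i) (row2 1 b0)) ->
    (<[row2 1%R b]> = <[(row2 1 (r ^+ i) *m M)%R]>)%VS.
  have di0 : d0 ^+ i != 0 by rewrite expf_neq0.
  have vM : row2 (d0 ^+ i * x) (d1 ^+ i * y) *m P = d0 ^+ i *: (row2 1 (r ^+ i) *m M).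
    rewrite row2M scalemxAl row2Z mul1r /r exprMn exprVn.
    by congr (row2 _ _ *m _); field.
  rewrite exy gPX vM => -[p ep]; apply: (@vline_eq _ _ (p^-1 * d0 ^+ i)).
    by rewrite row2_neq0 ?oner_eq0.
  rewrite -scalerA ep scalerA mulVf ?scale1r //; apply: contra_neq (uM i) => p0.
  by apply: (scalerI di0); rewrite ep p0 scale0r scaler0.
have lineB b : b \in B -> exists i, (<[row2 1%R b]> = <[(row2 1 (r ^+ i) *m M)%R]>)%VS.
  move=> Bb; have [k k0 kb] := conj_scale_trans Bb0 Bb; have [i ei] := powW k k0.
  by exists i; apply: lineX; rewrite -ei; apply/kb; exists 1; rewrite scale1r.
have Bline i : exists2 b, b \in B & (<[row2 1%R b]> = <[(row2 1 (r ^+ i) *m M)%R]>)%VS.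
  have [b Bb kb] := line_conj_scale (expf_neq0 i w0) Bb0.
  by exists b => //; apply: lineX; apply/kb; exists 1; rewrite scale1r.
(* If [r] has order [m], the theta slopes in [B] all occur among the slopes [f i] with [i < m], so
   [m] is at least theta. *)
have rP : theta.-primitive_root r.
  have [m mP m_theta] := prim_order_exists theta0 r1.
  suff /eqP <- : m == theta by [].
  rewrite eqn_leq dvdn_leq //= -B_size -[X in (_ <= X)%N](size_iota 0).
  pose f i := (row2 1 (r ^+ i) *m M) 0 (lift 0 0) / (row2 1 (r ^+ i) *m M) 0 0.
  rewrite -(size_map f); apply: uniq_leq_size => // b /lineB[i].
  rewrite -(prim_expr_mod mP) => e; apply/mapP; exists (i %% m)%N.
    by rewrite mem_iota ltn_mod (prim_order_gt0 mP).
  have /vlineP[k] : row2 1 b \in <[(row2 1 (r ^+ (i %% m)) *m M)%R]>%VS.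
    by rewrite -e memv_line.
  rewrite /f; move: (_ *m M) => u /rowP ek.
  move: (ek 0) (ek (lift 0 0)); rewrite !mxE /= => e0 ->.
  have u0 : u 0 0 != 0.
    by apply/eqP=> z; move/eqP: e0; rewrite z mulr0 oner_eq0.
  have -> : k = (u 0 0)^-1 by rewrite -[k](mulfK u0) -e0 mul1r.
  exact: mulrC.
(* From [r = w ^+ j] and [r ^+ theta = 1], theta * (q - 1) divides theta * j, hence q - 1 divides
   [j]. *)
have rX i : exists2 v, v != 0 & r ^+ i = v ^+ q.-1.
  have [j rj] : exists j, r = w ^+ j.
    apply: powW; apply/eqP=> z; move/eqP: r1.
    by rewrite z expr0n (gtn_eqF theta0) eq_sym oner_eq0.
  have /dvdnP[l jl] : (q.-1 %| j)%N.
    rewrite -(dvdn_pmul2l theta0) nE (prim_order_dvd wP) mulnC exprM -rj.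
    exact/eqP.
  exists (w ^+ (l * i)); first by rewrite expf_neq0.
  by rewrite rj jl -!exprM mulnAC.
(* Conversely, [v ^+ q.-1] is a theta-th root of unity, hence a power of [r]. *)
have Xr v : v != 0 -> exists i, v ^+ q.-1 = r ^+ i.
  move=> v0; have : (v ^+ q.-1) ^+ theta = 1 by rewrite -exprM mulnC nE Xn1.
  by case/(prim_rootP rP) => i ->; exists i.
exists M => //; apply/seteqP; split=> X /=.
  case=> b /lineB[i ->] <-; have [v v0 ->] := rX i.
  by exists <[row2 1%R (v ^+ q.-1)%R]>%VS; [exists v | rewrite pgl_line].
case=> _ [v v0 <-] <-; have [i ->] := Xr v v0; rewrite pgl_line.
by have [b Bb <-] := Bline i; exists b.
Qed.

End Transport.
End FieldExtension.

(** * Two-by-two matrices over a ring that need not be commutative *)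

Section Line.
Variable R : nzRingType.

Lemma row2_mul_col (x y : R) (u v : 'rV[R]_2) :
  row2 x y *m (col_mx u v : 'M_2) = x *: u + y *: v.
Proof.
rewrite -[row2 x y](@hsubmxK _ 1%N 1%N 1%N) (@mul_row_col _ 1%N 1%N 1%N 2%N).
have -> : lsubmx (row2 x y : 'rV_(1 + 1)) = x%:M.
  by apply/matrixP=> i j; rewrite !mxE (ord1 i) (ord1 j).
have -> : rsubmx (row2 x y : 'rV_(1 + 1)) = y%:M.
  by apply/matrixP=> i j; rewrite !mxE (ord1 i) (ord1 j).
by rewrite !mul_scalar_mx.
Qed.

Lemma col_row2_mul (a b c d a' b' c' d' : R) :
  (col_mx (row2 a b) (row2 c d) : 'M_2) *m col_mx (row2 a' b') (row2 c' d') =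
  col_mx (row2 (a * a' + b * c') (a * b' + b * d'))
         (row2 (c * a' + d * c') (c * b' + d * d')).
Proof. by rewrite (@mul_col_mx _ 1%N 1%N 2%N 2%N) !row2_mul_col !row2Z !row2D. Qed.

Lemma col_row2_1 : col_mx (row2 1 0) (row2 0 1) = 1%:M :> 'M[R]_2.
Proof.
rewrite -[RHS](@vsubmxK _ 1%N 1%N 2%N);
  apply: (congr2 (@col_mx R 1 1 2)); apply/matrixP=> i j;
  by rewrite !mxE (ord1 i); case: (unliftP ord0 j) => [k|] ->; rewrite ?(ord1 k).
Qed.

(** The completion is unitriangular. Admissibility gives access to the values of a projectivity,
    which are prescribed at admissible rows only. *)
Lemma admissible_row21 (b : R) : admissible (row2 1 b).
Proof.
exists (row2 0 1), (col_mx (row2 1 (- b)) (row2 0 1)).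
by rewrite !col_row2_mul !(mul0r, mul1r, mulr0, mulr1, addr0, add0r, addNr, subrr)
  col_row2_1.
Qed.

(** Subtracting [a] times the second row from the first leaves [(0, b - a * beta)]; the inverse
    comes from this elimination, with [d] the inverse of the Schur complement. *)
Lemma GL2_Schur (a b beta d : R) :
    (b - a * beta) * d = 1 -> d * (b - a * beta) = 1 ->
  GL2 (col_mx (row2 a b) (row2 1 beta)).
Proof.
move=> dV Vd.
exists (col_mx (row2 (- (beta * d)) (1 + beta * d * a)) (row2 d (- (d * a)))).
rewrite !col_row2_mul -col_row2_1; split; congr (col_mx (row2 _ _) (row2 _ _)).
- by rewrite -dV mulrBl mulrN mulrA addrC.
- transitivity (a - (b - a * beta) * d * a); last by rewrite dV mul1r subrr.
  by rewrite !mulrBl mulrDr mulr1 mulrN !mulrA opprB addrA.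
- by rewrite mul1r addNr.
- by rewrite mul1r mulrN mulrA addrK.
- by rewrite mulr1 mulNr addrC addrK.
- transitivity (beta - beta * (d * (b - a * beta))); last by rewrite Vd mulr1 subrr.
  by rewrite !mulrBr mulrDl mul1r mulNr !mulrA opprB addrC addrA.
- by rewrite mulr1 subrr.
by rewrite -Vd mulrBr mulNr mulrA.
Qed.

End Line.

(** * Points of [PG(1, E)] as [F]-subspaces of [L^2] *)

Section Coordinates.
Variables (F : finFieldType) (L : fieldExtType F).
Notation E := 'End(L).
Notation V := 'rV[L]_2.

Definition eval_row (w : 'rV[E]_2) (x : L) : V := map_mx (fun f : E => f x) w.

(** For [E(alpha, beta)] this is the [F]-subspace of all [(alpha x, beta x)]; matrices over [E] act
    on such subspaces through [mx_act]. *)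
Definition points (X : set 'rV[E]_2) : set V :=
  [set v | exists w x, X w /\ v = eval_row w x].

Definition mx_act (M : 'M[E]_2) (v : V) : V := \row_j \sum_i M i j (v 0 i).

Lemma rhoE (a x : L) : rho a x = a * x.
Proof. by rewrite /rho lfunE. Qed.

Lemma rho1 : rho (1 : L) = 1.
Proof. exact: amull1. Qed.

Lemma eval_row2 (f g : E) x : eval_row (row2 f g) x = row2 (f x) (g x).
Proof. by apply/rowP=> j; rewrite !mxE; case: ifP. Qed.

Lemma eval_rowZ (f : E) w x : eval_row (f *: w) x = eval_row w (f x).
Proof. by apply/rowP=> j; rewrite !mxE lfunE. Qed.

Lemma eval_rowD v w x : eval_row (v + w) x = eval_row v x + eval_row w x.
Proof. by apply/rowP=> j; rewrite !mxE lfunE. Qed.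

Lemma eval_row0 w : eval_row w 0 = 0.
Proof. by apply/rowP=> j; rewrite !mxE linear0. Qed.

(** Every vector is the value of a row at 1, so identities for [mx_act] reduce to matrix
    products. *)
Lemma row2_eval (x y : L) : row2 x y = eval_row (row2 (rho x) (rho y)) 1.
Proof. by rewrite eval_row2 !rhoE !mulr1. Qed.

Lemma points_cyc w v : points (cyc w) v <-> exists x, v = eval_row w x.
Proof.
split=> [[_ [x [[f ->] ->]]]|[x ->]]; first by exists (f x); rewrite eval_rowZ.
by exists w, x; split=> //; exists 1; rewrite scale1r.
Qed.

Lemma points_dilate X h v : h != 0 ->
  points (dilate X h) v <-> points X (h^-1 *: v).
Proof.
have ev w x : eval_row (w *m (rho h)%:M) x = h *: eval_row w x.
  apply/rowP=> j; rewrite !mxE (bigD1 j) //= big1 => [|k kj].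
    by rewrite addr0 !mxE eqxx mulr1n lfunE /= rhoE.
  by rewrite !mxE (negPf kj) mulr0n mulr0.
move=> h0; split=> [[_ [x [[w Xw <-] ->]]]|[w [x [Xw e]]]].
  by exists w, x; split=> //; rewrite ev scalerA mulVf // scale1r.
exists (w *m (rho h)%:M), x; split; first by exists w.
by rewrite ev -e scalerA mulfV // scale1r.
Qed.

Lemma mx_act_eval M w x : mx_act M (eval_row w x) = eval_row (w *m M) x.
Proof.
apply/rowP=> j; rewrite !mxE sum_lfunE; apply: eq_bigr => i _.
by rewrite lfunE /= mxE.
Qed.

Lemma mx_actM M N v : mx_act (M *m N) v = mx_act N (mx_act M v).
Proof. by rewrite (row2_eta v) row2_eval !mx_act_eval mulmxA. Qed.

Lemma mx_act1 v : mx_act 1%:M v = v.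
Proof. by rewrite (row2_eta v) row2_eval mx_act_eval mulmx1. Qed.

Lemma mx_actD M : {morph mx_act M : v w / v + w}.
Proof.
move=> v w; apply/rowP=> j; rewrite !mxE -big_split; apply: eq_bigr => i _.
by rewrite mxE linearD.
Qed.

Lemma mx_actF M (a : F) v : mx_act M (a%:A *: v) = a%:A *: mx_act M v.
Proof.
apply/rowP=> j; rewrite !mxE mulr_sumr; apply: eq_bigr => i _.
by rewrite mxE !mulr_algl linearZ.
Qed.

Lemma points_mx_act M N w v : M *m N = 1%:M ->
  points (cyc (w *m M)) (mx_act M v) <-> points (cyc w) v.
Proof.
move=> MN; rewrite !points_cyc; split=> -[x e]; exists x.
  by rewrite -(mx_act1 v) -MN mx_actM e -mx_act_eval -mx_actM MN mx_act1.
by rewrite e mx_act_eval.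
Qed.

Lemma points_row21 b v : points (cyc (row2 1 (rho b))) v <-> on_line b v.
Proof.
rewrite points_cyc; split=> -[x ->]; exists x.
  by rewrite eval_row2 rhoE lfunE /= row2Z mulr1 mulrC.
by rewrite eval_row2 rhoE lfunE /= row2Z mulr1 mulrC.
Qed.

(** The right side says that the subspaces of the two points share the nonzero vector
    [(a * u, b * u)]. *)
Lemma not_distantP (a b : L) (beta : E) : (a, b) != (0, 0) ->
  ~ distant (cyc (row2 (rho a) (rho b))) (cyc (row2 1 beta)) <->
  exists2 u, u != 0 & b * u = beta (a * u).
Proof.
move=> ab0; split=> [nd|[u u0 e]].
  (* If no such [u] exists, the Schur complement [d] is injective, hence invertible by finite
     dimension. *)
  apply: contra_notP nd => nu; pose d : E := rho b - rho a * beta.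
  have dE u : d u = b * u - beta (a * u).
    by rewrite /d add_lfunE opp_lfunE lfun_mulE !rhoE.
  have kd : lker d == 0%VS.
    apply/lker0P=> u v; rewrite !dE => /eqP; rewrite -subr_eq0 => /eqP e.
    apply/eqP; rewrite -subr_eq0; apply/negP=> /negP uv0; apply: nu.
    exists (u - v) => //; apply/eqP; rewrite -subr_eq0 -e !mulrBr linearB.
    by rewrite !opprD !opprK addrACA.
  exists (row2 (rho a) (rho b)), (row2 1 beta); split=> //.
  apply: (@GL2_Schur _ _ _ _ (d^-1)%VF).
    by rewrite -lfun_compE lker0_compVf.
  by rewrite -lfun_compE lker0_compfV.
case=> v [w [ev ew [N [MN _]]]].
pose z := row2 (a * u) (b * u).
have [x ex] : exists x, z = eval_row v x.
  by apply/points_cyc; rewrite -ev points_cyc; exists u; rewrite eval_row2 !rhoE.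
have [y ey] : exists y, z = eval_row w y.
  apply/points_cyc; rewrite -ew points_cyc; exists (a * u).
  by rewrite eval_row2 -e lfunE.
(* The common vector [z] has parameter [x] on [v] and [y] on [w], so the invertible matrix kills
   [(x, -y)]; then [x = 0] and [z = 0]. *)
have : mx_act (col_mx v w) (row2 x (- y)) = 0.
  rewrite row2_eval mx_act_eval row2_mul_col eval_rowD !eval_rowZ !rhoE !mulr1.
  have -> : eval_row w (- y) = - eval_row w y by apply/rowP=> j; rewrite !mxE linearN.
  by rewrite -ex -ey subrr.
move=> /(congr1 (mx_act N)); rewrite -mx_actM MN mx_act1.
have -> : mx_act N 0 = 0.
  by apply/rowP=> j; rewrite mxE big1 ?mxE // => i _; rewrite mxE linear0.
move=> /rowP/(_ 0); rewrite !mxE /= => x0.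
move: ex; rewrite x0 eval_row0 => /rowP ez; move/eqP: ab0; apply.
move: (ez 0) (ez (lift 0 0)); rewrite !mxE /=.
by move=> /eqP; rewrite mulf_eq0 (negPf u0) orbF => /eqP -> /eqP;
  rewrite mulf_eq0 (negPf u0) orbF => /eqP ->.
Qed.

(** The directions of the graph of [beta]. *)
Definition ratios (beta : E) : set L := [set b | exists2 u, u != 0 & b * u = beta u].

Lemma cyc_row21 (a b : L) : a != 0 ->
  cyc (row2 (rho a) (rho b)) = cyc (row2 1 (rho (b / a))).
Proof.
move=> a0; have ab0 : (a, b) != (0, 0) by rewrite xpair_eqE negb_and a0.
have b1 : (1, b / a) != (0, 0) :> L * L by rewrite xpair_eqE oner_eq0.
rewrite -(iota_line ab0) -rho1 -(iota_line b1); congr (Defs.iota _).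
apply: (@vline_eq _ _ _ _ a); first exact: row2_neq0.
by rewrite row2Z mulr1 [a * _]mulrC divfK.
Qed.

Lemma LT_ratios (beta : E) :
  LT (cyc (row2 1 beta)) = [set cyc (row2 1 (rho b)) | b in ratios beta].
Proof.
apply/seteqP; split=> X.
  case=> -[a [b [ab0 ->]]] /(not_distantP _ ab0)[u u0 e].
  (* The graph of [beta] meets the line of all [(0, y)] trivially. *)
  have a0 : a != 0.
    apply: contra_neq ab0 => a0; move/eqP: e.
    by rewrite a0 mul0r linear0 mulf_eq0 (negPf u0) orbF => /eqP ->.
  exists (b / a); last by rewrite cyc_row21.
  by exists (a * u); rewrite ?mulf_neq0 // -e mulrA divfK.
case=> b [u u0 e] <-.
have b1 : (1, b) != (0, 0) :> L * L by rewrite xpair_eqE oner_eq0.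
split; first by exists 1, b; rewrite rho1.
have := not_distantP beta b1; rewrite rho1 => nd.
by apply/nd; exists u; rewrite ?mul1r.
Qed.

Lemma iota_preim_lines (B : set L) :
  iota_preim [set cyc (row2 1 (rho b)) | b in B] = [set <[row2 1%R b]>%VS | b in B].
Proof.
apply/seteqP; split=> P.
  case=> dP [b Bb e]; exists b; first exact: Bb.
  have v0 : vpick P != 0 by rewrite vpick0 -dimv_eq0 dP.
  have -> : P = <[vpick P]>%VS.
    by apply/esym/eqP; rewrite eqEdim -memvE memv_pick dP dim_vline v0.
  (* The generator of [iota P] evaluated at 1 is [vpick P]. *)
  have [p ep] : on_line b (vpick P).
    apply/points_row21; rewrite e points_cyc; exists 1.
    by apply/rowP=> j; rewrite !mxE rhoE mulr1.
  by apply/esym; apply: (vline_eq v0 ep).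
case=> b Bb <-; split; first by rewrite dim_vline row2_neq0 ?oner_eq0.
have b1 : (1, b) != (0, 0) :> L * L by rewrite xpair_eqE oner_eq0.
by exists b; last rewrite (iota_line b1) rho1.
Qed.

End Coordinates.

(** * From the projectivity to the transported lines *)

Unset Implicit Arguments.

Theorem theorem24 (F : finFieldType) (L : fieldExtType F)
    (t_ge3 : (3 <= \dim {:L})%N)
    (beta : 'End(L)) (beta_unit : beta \is a GRing.unit)
    (T : set 'rV['End(L)]_2) (T_def : T = cyc (row2 1 beta))
    (T_scattered : scattered T)
    (phi : set 'rV['End(L)]_2 -> set 'rV['End(L)]_2)
    (phi_proj : projectivity phi)
    (phi_LT : phi @` (LT T) = LT' T) :
  pseudoregulus_type (LT T).
Proof.
have [M [N [MN NM]] phiM] := phi_proj.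
have LTE : LT T = [set cyc (row2 1 (rho b)) | b in ratios beta].
  by rewrite T_def LT_ratios.
(* Distinct slopes give distinct points, so the size of [LT T] counts slopes. *)
have ratiosI : (ratios beta #= `I_((#|F| ^ \dim {:L}).-1 %/ (#|F|).-1)%N)%card.
  apply: card_eq_trans T_scattered; rewrite LTE card_eq_sym.
  apply: inj_card_eq => b c _ _ e; apply: on_line_inj => v.
  by rewrite -!points_row21 e; exact: iff_refl.
have /finite_fsetP[B eB] : finite_set (ratios beta).
  by exists ((#|F| ^ \dim {:L}).-1 %/ (#|F|).-1)%N.
have sB : size (finmap.enum_fset B) = ((#|F| ^ \dim {:L}).-1 %/ (#|F|).-1)%N.
  by move: ratiosI; rewrite eB => /card_eq_fsetP.
(* [mx_act M] realizes [phi] on the subspaces of [L^2]. *)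
have phi_points b v :
    on_line b v <-> points (phi (cyc (row2 1 (rho b)))) (mx_act M v).
  by rewrite (phiM _ (admissible_row21 _)) (points_mx_act _ _ MN) points_row21.
rewrite /pseudoregulus_type LTE iota_preim_lines eB.
apply: (@transport_pseudoregulus _ _ (mx_act M) (mx_act N) (points T)) => //.
- by move=> v; rewrite -mx_actM MN mx_act1.
- by move=> v; rewrite -mx_actM NM mx_act1.
- exact: mx_actD.
- exact: mx_actF.
- move=> b Bb; have [h h0 e] : LT' T (phi (cyc (row2 1 (rho b)))).
    rewrite -phi_LT; exists (cyc (row2 1 (rho b))); last by [].
    by rewrite LTE eB; exists b; [exact: Bb | exact: erefl].
  by exists h => // v; rewrite phi_points -e points_dilate.
- move=> h h0; have : LT' T (dilate T h) by exists h.
  rewrite -phi_LT LTE eB => -[_ [b Bb <-] e].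
  by exists b => // v; rewrite phi_points e points_dilate.
exact: finmap.fset_uniq.
Qed.
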